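(* There is no infinite finitely presented torsion group $G$ such that, for some prime $p$, either (i) $G$ has a presentation $\langle X|R\rangle$ with $X$ finite and $\mathrm{def}_p(G;X,R)>1$, or (ii) $G$ has a presentation $\langle X|R\rangle$ with $X$ finite, $R$ infinite and $\mathrm{def}_p(G;X,R)=1$.
   Context: For a presentation $\langle X|R\rangle$ of $G$ with $X$ finite and $R$ a subset (finite or infinite) of the free group $F(X)$, the $p$-deficiency is $\mathrm{def}_p(G;X,R)=|X|-\sum_{r\in R}p^{-\nu_p(r)}$, where $\nu_p(r)=\max\{k\ge 0 : \exists w\in F(X),\ w^{p^k}=r\}$; if $R$ is infinite and the sum does not converge, then $\mathrm{def}_p(G;X,R)=-\infty$. A torsion group is a group in which every element has finite order. A group is finitely presented if it has some presentation with finitely many generators and finitely many relators. *)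

(* Defs.v *)
From HB Require Import structures.
From mathcomp Require Import all_boot all_order all_algebra.
From mathcomp Require Import all_classical all_reals all_analysis.

Set Implicit Arguments.
Unset Strict Implicit.
Unset Printing Implicit Defensive.

Import Order.TTheory GRing.Theory Num.Theory.

Local Open Scope classical_set_scope.
Local Open Scope group_scope.

(* F(X) as the group of reduced words in the letters x (encoded as (x, true))
   and x^-1 (encoded as (x, false)). *)
Section FreeGroup.
Variable X : choiceType.

Local Notation letter := (X * bool)%type.

Definition linv (a : letter) : letter := (a.1, ~~ a.2).

Definition reduced (s : seq letter) : bool := sorted (fun a b => b != linv a) s.

Record freegroup := FreeGroup { word :> seq letter; _ : reduced word }.

HB.instance Definition _ := [isSub for word].
HB.instance Definition _ := [Choice of freegroup by <:].

(* Left multiplication of a reduced word by a letter, and by a word. *)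
Definition lcons (a : letter) (s : seq letter) : seq letter :=
  if s is b :: t then if b == linv a then t else a :: s else [:: a].

Definition wmul (s t : seq letter) : seq letter := foldr lcons t s.

Definition winv (s : seq letter) : seq letter := rev (map linv s).

Lemma linvK : involutive linv.
Proof. by case=> x b; rewrite /linv /= negbK. Qed.

Lemma lcons_reduced a s : reduced s -> reduced (lcons a s).
Proof.
case: s => [//|b s] /=; case: ifP => [_|/negbT ba] ps.
  exact: path_sorted ps.
by rewrite /reduced /= ba.
Qed.

Lemma lconsK a s : reduced s -> lcons (linv a) (lcons a s) = s.
Proof.
case: s => [|b s] /=; first by rewrite linvK eqxx.
case: (eqVneq b (linv a)) => [-> {b}|ba _] /=; last by rewrite linvK eqxx.
by case: s => [//|c s] /= /andP[/negPf ->].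
Qed.

Lemma wmul_reduced s t : reduced t -> reduced (wmul s t).
Proof. by move=> rt; elim: s => //= a s; exact: lcons_reduced. Qed.

Lemma wmul_lcons a s t : reduced s -> reduced t ->
  wmul (lcons a s) t = lcons a (wmul s t).
Proof.
case: s => [//|b s] rs rt /=; case: eqP => [->|//].
by rewrite -{1}[a]linvK lconsK // wmul_reduced.
Qed.

Lemma wmulA s t u : reduced s -> reduced t -> reduced u ->
  wmul s (wmul t u) = wmul (wmul s t) u.
Proof.
move=> + rt ru; elim: s => [//|a s IH] /= rs.
by rewrite wmul_lcons ?wmul_reduced // IH //; exact: path_sorted rs.
Qed.

Lemma wmul1 s : reduced s -> wmul s [::] = s.
Proof.
elim: s => [//|a s IH] rs /=; rewrite IH; last exact: path_sorted rs.
by case: s rs {IH} => [//|b s] /= /andP[/negPf ->].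
Qed.

Lemma wmulV s : reduced s -> wmul (winv s) s = [::].
Proof.
have wcat u v t : wmul (u ++ v) t = wmul u (wmul v t).
  exact: foldr_cat.
suff wV u : reduced u -> wmul (winv s) (wmul s u) = u.
  by move=> rs; rewrite -{2}(wmul1 rs) wV.
move=> ru; elim: s => [//|a s IH] /=.
rewrite /winv /= rev_cons -cats1 wcat /= lconsK //.
exact: wmul_reduced.
Qed.

Lemma winv_reduced s : reduced s -> reduced (winv s).
Proof.
rewrite /reduced /winv rev_sorted sorted_map; apply: sub_sorted => a b.
move=> ba; change (linv a != linv (linv b)).
by rewrite linvK eq_sym.
Qed.

Lemma winvK : involutive winv.
Proof. by move=> s; rewrite /winv map_rev revK mapK //; exact: linvK. Qed.

Lemma word_reduced (w : freegroup) : reduced w. Proof. exact: (valP w). Qed.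

Definition fg_one := @FreeGroup [::] isT.
Definition fg_mul (u v : freegroup) :=
  FreeGroup (wmul_reduced u (word_reduced v)).
Definition fg_inv (u : freegroup) := FreeGroup (winv_reduced (word_reduced u)).

Fact fg_mulA : associative fg_mul.
Proof. by move=> u v w; apply/val_inj/wmulA; exact: word_reduced. Qed.
Fact fg_mul1g : left_id fg_one fg_mul.
Proof. by move=> u; exact/val_inj. Qed.
Fact fg_mulg1 : right_id fg_one fg_mul.
Proof. by move=> u; apply/val_inj/wmul1/word_reduced. Qed.
Fact fg_mulVg : left_inverse fg_one fg_inv fg_mul.
Proof. by move=> u; apply/val_inj/wmulV/word_reduced. Qed.
Fact fg_mulgV : right_inverse fg_one fg_inv fg_mul.
Proof.
move=> u; apply/val_inj => /=; rewrite -{1}[word u]winvK.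
exact/wmulV/winv_reduced/word_reduced.
Qed.

HB.instance Definition _ :=
  isGroup.Build freegroup fg_mulA fg_mul1g fg_mulg1 fg_mulVg fg_mulgV.

Definition freegen (x : X) : freegroup := @FreeGroup [:: (x, true)] isT.

Section Universal.
Variables (G : groupType) (f : X -> G).

Definition leval (a : letter) : G := if a.2 then f a.1 else (f a.1)^-1.

Definition free_lift (w : freegroup) : G := \prod_(a <- word w) leval a.

Lemma leval_linv a : leval (linv a) = (leval a)^-1.
Proof. by case: a => x [] //=; rewrite /leval /= invgK. Qed.

Fact free_lift_is_multiplicative : {morph free_lift : u v / u * v}.
Proof.
move=> u v; rewrite /free_lift /=.
elim: (word u) => [|a s IH] /=; first by rewrite big_nil mul1g.
rewrite big_cons -mulgA -IH.
case: (wmul s v) => [|b t] /=; first by rewrite !big_cons.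
case: eqP => [->|_]; last by rewrite big_cons.
by rewrite big_cons leval_linv mulVKg.
Qed.

HB.instance Definition _ :=
  isMultiplicative.Build freegroup G free_lift free_lift_is_multiplicative.

Lemma free_lift_gen x : free_lift (freegen x) = f x.
Proof. by rewrite /free_lift big_seq1. Qed.

Lemma free_lift_unique (phi : {multiplicative freegroup -> G}) :
  (forall x, phi (freegen x) = f x) -> phi =1 free_lift.
Proof.
move=> phif [s rs]; rewrite /free_lift /=.
have phi1 : phi 1 = 1.
  by apply: (mulgI (phi 1)); rewrite -gmulfM !mulg1.
elim: s rs => [|[x b] s IH] rs.
  by rewrite big_nil -phi1; congr (phi _); exact/val_inj.
have rs' : reduced s by exact: path_sorted rs.
have r1 : reduced [:: (x, b)] by [].
rewrite big_cons -(IH rs').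
have -> : FreeGroup rs = FreeGroup r1 * FreeGroup rs'.
  by apply/val_inj => /=; case: s rs {IH rs'} => [//|c s] /= /andP[/negPf ->].
rewrite gmulfM; congr (_ * _); rewrite /leval /=; case: b {rs} r1 => r1.
  by rewrite -phif; congr (phi _); exact/val_inj.
apply: (mulIg (f x)); rewrite mulVg -phif -gmulfM -phi1.
by congr (phi _); apply/val_inj; rewrite /= eqxx.
Qed.

End Universal.
End FreeGroup.

Definition normal_subgroup (G : groupType) (N : set G) : Prop :=
  [/\ N 1, forall x y, N x -> N y -> N (x / y) & forall x y, N x -> N (x ^ y)].

Definition normal_closure (G : groupType) (S : set G) : set G :=
  smallest (@normal_subgroup G) S.

(* The group G has the presentation < X | rels >. *)
Definition has_presentation (G : groupType) (X : finType)
    (rels : set (freegroup X)) : Prop :=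
  exists phi : {multiplicative freegroup X -> G},
    (forall g, exists w, phi w = g) /\
    phi @^-1` [set 1] = normal_closure rels.

Definition finitely_presented (G : groupType) : Prop :=
  exists (X : finType) (rels : set (freegroup X)),
    finite_set rels /\ has_presentation G rels.

Definition torsion (G : groupType) : Prop :=
  forall g : G, exists2 n : nat, (0 < n)%N & g ^+ n = 1.

Section Deficiency.
Local Open Scope ring_scope.
Variables (R : realType) (p : nat) (X : finType).

Definition is_ppow (r : freegroup X) (k : nat) : Prop :=
  exists w : freegroup X, (w ^+ (p ^ k)%N)%g = r.

Definition is_nu (r : freegroup X) (k : nat) : Prop :=
  is_ppow r k /\ forall j, is_ppow r j -> (j <= k)%N.

(* None stands for an infinite value: for p prime, the maximum fails to exist
   only for r = 1, which is a p^k-th power for every k. *)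
Definition nu (r : freegroup X) : option nat :=
  if pselect (exists k, is_nu r k) is left ex_k then Some (projT1 (cid ex_k))
  else None.

Definition nu_weight (r : freegroup X) : R :=
  if nu r is Some k then p%:R ^- k else 0.

(* A divergent sum is +oo, and then the deficiency is -oo. *)
Definition pdef (rels : set (freegroup X)) : \bar R :=
  (#|X|%:R%:E - \esum_(r in rels) (nu_weight r)%:E)%E.

End Deficiency.

Lemma nuP p (X : finType) (r : freegroup X) k : nu p r = Some k <-> is_nu p r k.
Proof.
rewrite /nu; case: pselect => [ex_k|nex_k]; last first.
  by split=> // nu_k; case: nex_k; exists k.
case: cid => j /= nu_j; split=> [[<-//]|nu_k]; congr Some; apply/eqP.
by rewrite eqn_leq nu_j.2 ?nu_k.2 //; [exact: nu_j.1|exact: nu_k.1].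
Qed.

(* Main.v *)
(* It suffices to treat finitely many relators w_i^(p^k_i) with
   1 + sum_i p^-k_i < |X|, and to find an element of infinite order.
   Among the finite quotients P of G choose one in which the orders p^j_i of the
   w_i are maximal.  An integral 1-cochain phi on the Cayley graph of P can be
   integrated along words; it must be found nonzero on some closed path and zero
   on all translates of the relators, since it then detects a loop of infinite
   order in G.  Relators with j_i = k_i impose only |P| / p^k_i conditions each,
   so together with the |P| conditions of being divergence free (which exclude
   gradients) there are fewer conditions than the |P| |X| unknowns.  The other
   relators take care of themselves: their integrals are those of w_i^(p^j_i)
   times a positive power of p, so if the latter are divisible by p^e, then phi
   mod p^(e+1) is zero on all relators and yields a larger finite quotient; by
   maximality w_i^(p^j_i) dies there, so its integrals are divisible by p^(e+1).
   Hence they are zero. *)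
From HB Require Import structures.
Require Import Defs.
From mathcomp Require Import all_boot all_order all_algebra all_fingroup cyclic.
From mathcomp Require Import all_classical all_reals all_analysis.

Set Implicit Arguments.
Unset Strict Implicit.
Unset Printing Implicit Defensive.

Import Order.TTheory GRing.Theory Num.Theory.

Local Open Scope classical_set_scope.
Local Open Scope group_scope.

Fact free_lift1 (X : choiceType) (G : groupType) (f : X -> G) :
  free_lift f 1 = 1.
Proof. by apply: (mulgI (free_lift f 1)); rewrite -gmulfM !mulg1. Qed.

HB.instance Definition _ (X : choiceType) (G : groupType) (f : X -> G) :=
  Multiplicative_isUMagmaMorphism.Build (freegroup X) G (free_lift f)
    (free_lift1 f).

(** * Lengths of powers and roots in free groups *)

Section Roots.
Variable X : choiceType.
Implicit Types (s t u c : seq (X * bool)) (w r : freegroup X).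

Lemma reduced_cat_overlap s c t : c != [::] ->
  reduced (s ++ c) -> reduced (c ++ t) -> reduced (s ++ c ++ t).
Proof.
case: c => // a c _; rewrite /reduced.
case: s => [//|b s]; rewrite !cat_cons /= !cat_path /= cat_path.
by case/and3P=> -> -> _ /andP[-> ->].
Qed.

Lemma reduced_catl s t : reduced (s ++ t) -> reduced s.
Proof. by case: s => [//|a s]; rewrite /reduced /= cat_path => /andP[]. Qed.

Lemma reduced_catr s t : reduced (s ++ t) -> reduced t.
Proof. by elim: s => [//|a s IH] /path_sorted. Qed.

Lemma wmul_cat s t : reduced (s ++ t) -> wmul s t = s ++ t.
Proof.
elim: s => [//|a s IH] /= r; rewrite IH; last exact: path_sorted r.
by case: (s ++ t) r => [//|b v] /= /andP[/negPf ->].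
Qed.

Lemma winvKl u t : reduced u -> reduced t -> wmul (winv u) (wmul u t) = t.
Proof. by move=> ru rt; rewrite wmulA ?winv_reduced // wmulV. Qed.

(** Strip the first and last letters as long as they are mutually inverse; [reduced (c ++ c)]
    expresses that the remaining core is cyclically reduced. *)
Lemma cyclic_decomposition s : reduced s -> s != [::] ->
  exists u c, [/\ s = u ++ c ++ winv u, c != [::] & reduced (c ++ c)].
Proof.
have [n] := ubnP (size s); elim: n s => [//|n IH] [//|a s].
case/lastP: s => [|s b] size_s red_s _.
  exists [::], [:: a]; split=> //=; rewrite /reduced /= andbT.
  by case: a {size_s red_s} => x []; apply/eqP => -[].
have [b_eq|b_neq] := eqVneq b (linv a); last first.
  exists [::], (a :: rcons s b); split=> //; first by rewrite cats0.
  rewrite /reduced /= cat_path last_rcons /=; move: red_s; rewrite /reduced /= => red_s.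
  rewrite red_s andbT /=; apply: contra b_neq => /eqP ->.
  by rewrite linvK.
have red_t : reduced s.
  by apply: (reduced_catl (t := [:: b])); rewrite cats1; exact: path_sorted red_s.
have s_neq0 : s != [::].
  by apply: contraTneq red_s => ->; rewrite b_eq /reduced /= eqxx.
have [|u [c [sE c_neq0 red_cc]]] := IH s _ red_t s_neq0.
  by move: size_s; rewrite /= size_rcons ltnS => /ltnW.
exists (a :: u), c; split=> //.
by rewrite sE b_eq /winv /= rev_cons -!cats1 -!catA.
Qed.

(** With w = u c u^-1 and c cyclically reduced, the word u c^n u^-1 is already reduced, so every
    further power adds the length of c. *)
Lemma size_expg w n : w != 1 -> (1 < n)%N -> (size w < size (w ^+ n)).
Proof.
case: w => s red_s w_neq1 n_gt1; have s_neq0 : s != [::].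
  by apply: contraNneq w_neq1 => s0; apply/eqP/val_inj.
have [u [c [sE c_neq0 red_cc]]] := cyclic_decomposition red_s s_neq0 => {w_neq1}.
(* [tail n] is the word c^n u^-1. *)
pose tail n := iter n (cat c) (winv u).
have red_c : reduced (c ++ winv u) by move: red_s; rewrite sE => /reduced_catr.
have red_uc : reduced (u ++ c) by move: red_s; rewrite sE catA => /reduced_catl.
have red_tail m : reduced (tail m.+1).
  by elim: m => [//|m IH]; apply: reduced_cat_overlap.
have red_u m : reduced (u ++ tail m.+1) by apply: reduced_cat_overlap => //; exact: red_tail.
have expE m : word (FreeGroup red_s ^+ m.+1) = u ++ tail m.+1.
  elim: m => [|m IH]; first by rewrite expg1 /= sE.
  rewrite expgS /= IH {1}sE -(wmul_cat (red_u m)) catA {1}/wmul foldr_cat -/(wmul _ _) -/(wmul _ _).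
  rewrite winvKl ?(reduced_catl red_uc) // wmul_cat; first by rewrite -catA.
  by rewrite -catA; exact: (red_u m.+1).
case: n n_gt1 => [//|[//|n]] _; rewrite expE /= sE !size_cat !ltn_add2l.
have le_tail : (size (winv u) <= size (tail n))%N.
  by elim: n => [//|n IH] /=; rewrite size_cat (leq_trans IH) ?leq_addl.
by rewrite -add1n leq_add // lt0n size_eq0.
Qed.

End Roots.

(** Each p-th power lengthens a nontrivial word, so a nontrivial p^k-th power has length greater
    than k. This bounds the possible exponents by the length of [r]. *)
Lemma nu_neq1 p (X : finType) (r : freegroup X) : (1 < p)%N -> r != 1 ->
  exists k, nu p r = Some k.
Proof.
move=> p_gt1 r_neq1.
have size_root (w : freegroup X) k : w != 1 -> (k < size (w ^+ (p ^ k)%N))%N.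
  move=> w_neq1; elim: k => [|k IH].
    by rewrite expn0 expg1 lt0n size_eq0; apply: contra w_neq1 => /eqP w0; apply/eqP/val_inj.
  rewrite expnSr expgM; apply: leq_ltn_trans (IH) _; apply: size_expg => //.
  by apply: contraTneq IH => ->.
have bound k : `[< is_ppow p r k >] -> (k <= size r)%N.
  move=> /asboolP[w wr]; rewrite -wr ltnW // size_root //.
  by apply: contra r_neq1 => /eqP w1; rewrite -wr w1 expg1n.
have ex0 : exists k, `[< is_ppow p r k >].
  by exists 0%N; apply/asboolP; exists r; rewrite expn0 expg1.
case: (ex_maxnP ex0 bound) => k /asboolP rk maxk; exists k.
by apply/nuP; split=> // j rj; apply: maxk; apply/asboolP.
Qed.

(** * Normal closures and finite presentability *)

Section NormalClosure.
Variable G : groupType.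
Implicit Types (N S : set G) (x y : G).

Lemma normal_closure_normal S : normal_subgroup (normal_closure S).
Proof.
split=> [N [[] //]|x y Sx Sy N NS|x y Sx N NS]; have [[_ Ndiv Nconj] _] := NS.
  by apply: Ndiv; [exact: Sx N NS|exact: Sy N NS].
by apply: Nconj; exact: Sx N NS.
Qed.

Lemma normal_closure_sub S T : S `<=` normal_closure T ->
  normal_closure S `<=` normal_closure T.
Proof. by apply: smallest_sub; exact: normal_closure_normal. Qed.

Lemma normal_subgroupV N x : normal_subgroup N -> N x -> N x^-1.
Proof. by case=> N1 Ndiv _ Nx; rewrite -[x^-1]div1g; exact: Ndiv. Qed.

Lemma normal_subgroupM N x y : normal_subgroup N -> N x -> N y -> N (x * y).
Proof.
move=> nN Nx Ny; rewrite -[y]invgK; case: (nN) => _ Ndiv _; apply: Ndiv => //.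
exact: normal_subgroupV.
Qed.

(** The elements lying in the normal closure of some finite part of [S] form a normal subgroup that
    contains [S]. *)
Lemma normal_closure_finite S x : normal_closure S x ->
  exists2 s : seq G, [set` s] `<=` S & normal_closure [set` s] x.
Proof.
apply: (@smallest_sub _ _ _ [set y | exists2 s : seq G,
  [set` s] `<=` S & normal_closure [set` s] y]); last first.
  move=> y Sy; exists [:: y] => [z|]; first by rewrite /= inE => /eqP ->.
  by apply: sub_gen_smallest; rewrite /= inE.
split=> [|y z [s sS ys] [t tS zt]|y z [s sS ys]].
- by exists [::] => //; case: (normal_closure_normal [set` [::]]).
- exists (s ++ t) => [u|]; first by rewrite /= mem_cat => /orP[/sS|/tS].
  case: (normal_closure_normal [set` s ++ t]) => _ div _; apply: div.
    by move: ys; apply: normal_closure_sub => u us; apply: sub_gen_smallest; rewrite /= mem_cat us.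
  by move: zt; apply: normal_closure_sub => u ut; apply: sub_gen_smallest; rewrite /= mem_cat ut orbT.
- by exists s => //; case: (normal_closure_normal [set` s]) => _ _; apply.
Qed.

Lemma normal_closure_finite_sub S (s : seq G) : [set` s] `<=` normal_closure S ->
  exists2 t : seq G, [set` t] `<=` S & [set` s] `<=` normal_closure [set` t].
Proof.
elim: s => [_|x s IH sS]; first by exists [::].
have [|t tS st] := IH; first by move=> y ys; apply: sS; rewrite /= inE (_ : y \in s) ?orbT.
have [u uS xu] := normal_closure_finite (sS x (mem_head x s)).
exists (t ++ u) => [y|y]; first by rewrite /= mem_cat => /orP[/tS|/uS].
rewrite /= inE => /predU1P[->|/st].
  by move: xu; apply: normal_closure_sub => z zu; apply: sub_gen_smallest; rewrite /= mem_cat zu orbT.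
by apply: normal_closure_sub => z zt; apply: sub_gen_smallest; rewrite /= mem_cat zt.
Qed.

End NormalClosure.

Lemma freegroup_ind (X : choiceType) (N : set (freegroup X)) :
  N 1 -> (forall u v, N u -> N v -> N (u * v)) -> (forall u, N u -> N u^-1) ->
  (forall x, N (freegen x)) -> forall w, N w.
Proof.
move=> N1 NM NV Ngen [s rs]; elim: s rs => [|[x b] s IH] rs.
  by move: N1; congr N; exact/val_inj.
have rs' : reduced s by exact: path_sorted rs.
suff -> : FreeGroup rs = (if b then freegen x else (freegen x)^-1) * FreeGroup rs'.
  by apply: NM => //; case: b {rs}; [exact: Ngen|exact/NV/Ngen].
apply/val_inj; case: b rs => rs /=.
  by case: s rs {IH rs'} => [//|c s] /= /andP[/negPf ->].
by case: s rs {IH rs'} => [//|c s] /= /andP[/negPf ->].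
Qed.

(** Tietze's argument: finite presentability does not depend on the finite generating family. *)
Lemma finitely_presented_kernel (G : groupType) (X : finType)
    (phi : {multiplicative freegroup X -> G}) :
  finitely_presented G -> (forall g, exists w, phi w = g) ->
  exists s : seq (freegroup X), phi @^-1` [set 1] = normal_closure [set` s].
Proof.
move=> [Y [rels [/finite_seqP[rs ->] [psi [psi_surj kerpsi]]]]] phi_surj.
(* Words expressing each generating family through the other. *)
have [alpha phi_alpha] := choice (fun y => phi_surj (psi (freegen y))).
have [beta psi_beta] := choice (fun x => psi_surj (phi (freegen x))).
have phiE : phi =1 free_lift (phi \o @freegen X) by exact: free_lift_unique.
have psiE : psi =1 free_lift (psi \o @freegen Y) by exact: free_lift_unique.
have phi_lift v : phi (free_lift alpha v) = psi v.
  rewrite psiE; apply: (@free_lift_unique _ _ _ (phi \o free_lift alpha)) => y /=.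
  by rewrite free_lift_gen.
have psi_lift w : psi (free_lift beta w) = phi w.
  rewrite phiE; apply: (@free_lift_unique _ _ _ (psi \o free_lift beta)) => x /=.
  by rewrite free_lift_gen.
(* The old relators rewritten over [X], and the relations identifying each generator [x] with its
   double translation. *)
pose s := [seq free_lift alpha r | r <- rs] ++
  [seq (freegen x)^-1 * free_lift alpha (beta x) | x <- enum X].
pose N := normal_closure [set` s]; have nN : normal_subgroup N by exact: normal_closure_normal.
have [N1 Ndiv Nconj] := nN.
exists s; apply/seteqP; split=> w /=.
  move=> phi_w.
  (* Modulo [N], translating to [Y] and back changes no word; it suffices to check this on
     generators. *)
  have diff u : N (u^-1 * free_lift alpha (free_lift beta u)).
    move: u; apply: (@freegroup_ind _ (fun u =>
      N (u^-1 * free_lift alpha (free_lift beta u)))) => [|u v Nu Nv|u Nu|x].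
    - by rewrite !gmulf1 mulg1 invg1.
    - rewrite !gmulfM /= invgM.
      set a := free_lift alpha _ in Nu *; set b := free_lift alpha _ in Nv *.
      have -> : v^-1 * u^-1 * (a * b) = (u^-1 * a) ^ v * (v^-1 * b).
        by rewrite /conjg !mulgA mulgK.
      exact: normal_subgroupM nN (Nconj _ _ Nu) Nv.
    - rewrite !gmulfV /= invgK; set a := free_lift alpha _ in Nu *.
      have -> : u * a^-1 = ((u^-1 * a)^-1) ^ u^-1.
        by rewrite /conjg invgM !invgK !mulgA mulgK.
      exact: Nconj (normal_subgroupV nN Nu).
    - rewrite free_lift_gen; apply: sub_gen_smallest; rewrite /= mem_cat.
      by apply/orP; right; apply: map_f; rewrite mem_enum.
  have Nw : N (free_lift alpha (free_lift beta w)).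
    have : normal_closure [set` rs] (free_lift beta w) by rewrite -kerpsi /= psi_lift.
    apply: (@smallest_sub _ _ _ (free_lift alpha @^-1` N)) => [|r rrs].
      split=> [|u v Nu Nv|u v Nu] /=; first by rewrite gmulf1.
        by rewrite gmulfF; exact: Ndiv.
      by rewrite gmulfJ; exact: Nconj.
    by apply: sub_gen_smallest; rewrite /= mem_cat map_f.
  have -> : w = free_lift alpha (free_lift beta w) *
      (w^-1 * free_lift alpha (free_lift beta w))^-1.
    by rewrite invgM invgK mulgA mulgV mul1g.
  exact: Ndiv.
apply: (@smallest_sub _ _ _ (phi @^-1` [set 1])) => [|{}w /=].
  split=> [|u v|u v] /=; rewrite !phiE; first by rewrite gmulf1.
    by move=> u1 v1; rewrite gmulfF /= u1 v1 divgg.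
  by move=> u1; rewrite gmulfJ /= u1 conj1g.
rewrite mem_cat => /orP[/mapP[r rrs ->]|/mapP[x _ ->]] /=.
  rewrite phi_lift; have : normal_closure [set` rs] r by exact: sub_gen_smallest.
  by rewrite -kerpsi.
by rewrite phiE gmulfM gmulfV /= -!phiE phi_lift psi_beta mulVg.
Qed.

(** * Integration of 1-cochains along words in a Cayley graph *)

Section PathIntegral.
Variables (X : choiceType) (P : groupType) (f : X -> P) (A : zmodType).
Implicit Types (phi : P * X -> A) (g : P) (u v w : freegroup X).

(** The cochain value [phi (g, x)] belongs to the edge leaving [g] with label [x]; an inverse letter
    runs backwards along the edge that ends at [g]. *)
Definition edge_int phi g (a : X * bool) : A :=
  if a.2 then phi (g, a.1) else (- phi ((g * (f a.1)^-1)%g, a.1))%R.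

(* The edge of the Cayley graph from g labelled x ends at g * f x. *)
Fixpoint path_int phi g (s : seq (X * bool)) : A :=
  if s is a :: t then (edge_int phi g a + path_int phi (g * leval f a)%g t)%R
  else 0%R.

(** When [a] cancels the first letter of [s], the path crosses one edge forth and back, and the two
    contributions cancel. *)
Lemma path_int_lcons phi g a s : path_int phi g (lcons a s) =
  (edge_int phi g a + path_int phi (g * leval f a)%g s)%R.
Proof.
case: s => [//|b t] /=; case: eqP => [->|//].
rewrite leval_linv mulgK addrA -[LHS]add0r; congr (_ + _)%R.
case: a => x [] /=; rewrite /edge_int /leval /= ?mulgK ?subrr //.
by rewrite addNr.
Qed.

Lemma path_intM phi g u v : path_int phi g (u * v) =
  (path_int phi g u + path_int phi (g * free_lift f u)%g v)%R.
Proof.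
rewrite /free_lift /=; elim: (word u) g => [|a s IH] g /=.
  by rewrite big_nil mulg1 add0r.
by rewrite path_int_lcons IH big_cons mulgA addrA.
Qed.

Lemma path_intV phi g u :
  path_int phi g u^-1 = (- path_int phi (g * (free_lift f u)^-1)%g u)%R.
Proof.
apply/eqP; rewrite -addr_eq0 -gmulfV -path_intM mulVg.
by [].
Qed.

Lemma path_int_gen phi g x : path_int phi g (freegen x) = phi (g, x).
Proof. by rewrite /= addr0. Qed.

Lemma path_int_loopX phi g w n : free_lift f w = 1 ->
  path_int phi g (w ^+ n) = (path_int phi g w *+ n)%R.
Proof.
move=> w1; elim: n => [|n IH]; first by rewrite expg0 mulr0n.
by rewrite expgS path_intM w1 mulg1 mulrS; congr (_ + _)%R.
Qed.

(** Asking for zero from every base point makes the set stable under conjugation. *)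
Definition null_loops phi : set (freegroup X) :=
  [set w | free_lift f w = 1 /\ forall g, path_int phi g w = 0%R].

Lemma null_loops_normal phi : normal_subgroup (null_loops phi).
Proof.
split=> [|u v [u1 u0] [v1 v0]|u v [u1 u0]].
- by split=> //; exact: gmulf1.
- split=> [|g]; first by rewrite gmulfF /= u1 v1 divgg.
  by rewrite path_intM path_intV u0 v0 oppr0 addr0.
- split=> [|g].
    by rewrite gmulfJ /= u1 conj1g.
  rewrite /conjg !path_intM path_intV gmulfV /= u1 mulg1 u0 add0r.
  by rewrite addNr.
Qed.

End PathIntegral.

(** Serves both for the inclusion of the integers in the rationals and for reduction modulo powers
    of p. *)
Lemma path_int_raddf (X : choiceType) (P : groupType) (f : X -> P)
    (A B : zmodType) (h : {additive A -> B}) (phi : P * X -> A) g s :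
  path_int f (h \o phi) g s = h (path_int f phi g s).
Proof.
elim: s g => [|[x b] s IH] g /=; first by rewrite raddf0.
by rewrite IH raddfD; congr (_ + _)%R; case: b; rewrite /edge_int /= ?raddfN.
Qed.

Lemma path_int_linear (X : finType) (P : finGroupType) (f : X -> P)
    (K : pzRingType) g s :
  linear (fun phi : {ffun P * X -> K^o} => path_int f phi g s : K^o).
Proof.
move=> c phi psi; elim: s g => [|[x b] s IH] g /=; first by rewrite scaler0 addr0.
rewrite IH scalerDr [RHS]addrACA; congr (_ + _)%R.
by case: b; rewrite /edge_int /= !ffunE // scalerN opprD.
Qed.

(** * Linear systems with fewer equations than unknowns, and integral solutions *)

Lemma dim_common_zeros (K : fieldType) (V : vectType K) (J : eqType)
    (F : J -> {linear V -> K^o}) (s : seq J) :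
  exists2 U : {vspace V}, (\dim {:V} <= \dim U + size s)%N &
    forall v j, v \in U -> j \in s -> F j v = 0%R.
Proof.
elim: s => [|j s [U dimU U0]]; first by exists fullv; rewrite ?addn0.
exists (U :&: lker (linfun (F j)))%VS => [|v i].
  apply: leq_trans dimU _; rewrite /= addnS -addSn leq_add2r.
  rewrite -(limg_ker_dim (linfun (F j)) U) -addn1 leq_add2l.
  by apply: leq_trans (dimvS (subvf _)) _; rewrite dimvf.
rewrite memv_cap memv_ker lfunE /= => /andP[vU /eqP Fv].
by rewrite inE => /predU1P[->|/(U0 _ _ vU)].
Qed.

Lemma common_zero_neq0 (K : fieldType) (V : vectType K) (J : eqType)
    (F : J -> {linear V -> K^o}) (s : seq J) : (size s < \dim {:V})%N ->
  exists2 v : V, v != 0%R & forall j, j \in s -> F j v = 0%R.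
Proof.
move=> s_lt; have [U dimU U0] := dim_common_zeros F s.
have U_neq0 : U != 0%VS.
  by apply: contraTN s_lt => /eqP U_eq0; move: dimU; rewrite U_eq0 dimv0 -leqNgt.
by exists (vpick U) => [|j]; [rewrite vpick0|apply: U0; rewrite memv_pick].
Qed.

Lemma clear_denominators (T : finType) (phi : T -> rat) :
  exists2 N : rat, N != 0%R & exists psi : T -> int,
    forall t, (N * phi t = (psi t)%:~R)%R.
Proof.
exists (\prod_t (denq (phi t))%:~R)%R.
  by apply/prodf_neq0 => t _; rewrite intr_eq0 denq_neq0.
exists (fun t => \prod_(u | u != t) denq (phi u) * numq (phi t))%R => t.
rewrite (bigD1 t) //= mulrAC [(_ * phi t)%R]mulrC rmorphM rmorph_prod /=.
by rewrite -[X in (X * _ * _)%R]divq_num_den mulfVK ?intr_eq0 ?denq_neq0 // mulrC.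
Qed.

(** * Potentials and divergence-free cochains *)

Section Harmonic.
Variables (X : finType) (P : finGroupType) (f : X -> P).

(** The integral from a base point depends only on the end point, and so defines a potential. *)
Lemma path_int_potential (A : zmodType) (phi : P * X -> A) :
    (forall g w, free_lift f w = 1 -> path_int f phi g w = 0%R) ->
  exists a : P -> A, forall g x, phi (g, x) = (a (g * f x)%g - a g)%R.
Proof.
move=> loop0.
(* The values of [f] need not generate [P], so each component of the Cayley graph gets its own base
   point. *)
pose orb g : set P := [set h | exists w, h = g * free_lift f w].
pose base g := xget 1 (orb g).
have base_orb g : exists w, g = base g * free_lift f w.
  have [w gw] : orb g (base g).
    by apply: xgetPex; exists g, 1; rewrite gmulf1 mulg1.
  by exists w^-1; rewrite gw gmulfV /= mulgK.
have [W gW] := choice base_orb.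
exists (fun g => path_int f phi (base g) (W g)) => g x.
have base_mul : base (g * f x) = base g.
  congr (xget 1 _); apply/seteqP; split=> _ [w ->].
    by exists (freegen x * w); rewrite gmulfM /= free_lift_gen mulgA.
  by exists ((freegen x)^-1 * w); rewrite gmulfM gmulfV /= free_lift_gen mulgA mulgK.
set b := base g in base_mul gW *.
(* The chosen path to [g * f x] and the path through [g] differ by a loop, whose integral is
   zero. *)
have -> : W (g * f x) = W (g * f x) * (W g * freegen x)^-1 * (W g * freegen x).
  by rewrite mulgVK.
have loop1 : free_lift f (W (g * f x) * (W g * freegen x)^-1) = 1.
  rewrite gmulfM gmulfV gmulfM /= free_lift_gen.
  apply: (mulgI b); rewrite mulgA -[in LHS]base_mul -gW mulg1.
  by rewrite invgM mulgA mulgK {1}[g]gW /b mulgK.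
rewrite base_mul path_intM loop1 loop0 // add0r mulg1 path_intM -gW.
by rewrite path_int_gen addrC addKr.
Qed.

(** The net flow into the vertex [g]. *)
Definition divergence (phi : {ffun P * X -> rat^o}) g : rat^o :=
  (\sum_x (phi ((g * (f x)^-1)%g, x) - phi (g, x)))%R.

Lemma divergence_linear g : linear (divergence ^~ g).
Proof.
move=> c phi psi; rewrite /divergence scaler_sumr -big_split /=.
by apply: eq_bigr => x _; rewrite !ffunE scalerBr opprD addrACA.
Qed.

(* Summation by parts: a gradient is orthogonal to divergence-free functions. *)
Lemma harmonic_eq0 (phi : {ffun P * X -> rat^o}) :
    (forall g, divergence phi g = 0%R) ->
    (forall g w, free_lift f w = 1 -> path_int f phi g w = 0%R) -> phi = 0%R.
Proof.
move=> div0 /path_int_potential[a phiE].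
have sq_sum : (\sum_y phi y * phi y = 0 :> rat)%R.
  transitivity (\sum_g a g * divergence phi g : rat)%R; last first.
    by rewrite big1 // => g _; rewrite div0 mulr0.
  transitivity (\sum_x \sum_g phi (g, x) * phi (g, x) : rat)%R.
    rewrite exchange_big pair_bigA /=.
    by apply: eq_bigr => -[].
  rewrite /divergence; under [RHS]eq_bigr do rewrite mulr_sumr.
  rewrite [RHS]exchange_big; apply: eq_bigr => x _ /=.
  under [RHS]eq_bigr do rewrite mulrBr.
  rewrite sumrB [X in (X - _)%R](reindex_inj (mulIg (f x))) /= -sumrB.
  apply: eq_bigr => g _; rewrite mulgK -mulrBl {1}phiE.
  by [].
apply/ffunP => y; rewrite ffunE; apply/eqP; rewrite -[_ == _]orbb -mulf_eq0.
move: sq_sum => /eqP; rewrite psumr_eq0 => [/allP /(_ y)|z _]; last first.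
  exact: sqr_ge0.
by rewrite mem_index_enum => /(_ isT).
Qed.

End Harmonic.
(** The letter [x] acts by (g, z) -> (g f(x), z + phi(g, x)). The finite group so obtained is the
    larger quotient: a word trivial in it is a loop in [P] with zero integral from every vertex. *)
Lemma affine_action (X : choiceType) (P : finGroupType) (f : X -> P)
    (A : finZmodType) (phi : P * X -> A) :
  exists F : X -> {perm (P * A)}, forall w g z,
    free_lift F w (g, z) = (g * free_lift f w, (z + path_int f phi g w)%R).
Proof.
have inj_F x : injective (fun y : P * A => (y.1 * f x, (y.2 + phi (y.1, x))%R)).
  by move=> [g z] [h t] /= [/mulIg-> /addIr->].
pose F x := perm (inj_F x); exists F.
have FE a g z : leval F a (g, z) = (g * leval f a, (z + edge_int f phi g a)%R).
  case: a => x []; rewrite /leval /edge_int /=; first by rewrite permE.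
  apply: (canLR (permK (F x))); rewrite permE /= mulgVK.
  by rewrite addrNK.
move=> w; rewrite /free_lift; elim: (word w) => [|a s IH] g z /=.
  by rewrite !big_nil perm1 mulg1 addr0.
by rewrite !big_cons permM FE IH mulgA addrA.
Qed.

Lemma intr_Zp_eq0 q (z : int) : (1 < q)%N ->
  (z%:~R == 0 :> 'Z_q)%R = (q %| `|z|)%N.
Proof.
move=> q_gt1; have natr n : (n%:R == 0 :> 'Z_q)%R = (q %| n)%N.
  by rewrite -val_eqE /= val_Zp_nat.
by case: z => n; [exact: natr|rewrite NegzE mulrNz oppr_eq0; exact: natr].
Qed.

(** Moving the start of the loop w^n by a power of w only rotates the loop cyclically. Hence one
    equation per coset of the cyclic group generated by the image of w is enough. *)
Lemma path_int_powX (X : choiceType) (P : groupType) (f : X -> P)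
    (A : zmodType) (phi : P * X -> A) g w n i : free_lift f (w ^+ n) = 1 ->
  path_int f phi (g * free_lift f w ^+ i)%g (w ^+ n) = path_int f phi g (w ^+ n).
Proof.
move=> wn1; elim: i => [|i IH]; first by rewrite expg0 mulg1.
rewrite -IH expgSr mulgA; set h := g * _.
apply: (addrI (path_int f phi h w)); rewrite -path_intM -expgS expgSr path_intM.
by rewrite wn1 mulg1 addrC.
Qed.

(** * The maximal finite quotient, its cochain, and an element of infinite order *)

Section Relators.
Variables (X : finType) (p : nat) (rs : seq (freegroup X * nat)).
Hypothesis p_prime : prime p.

Definition relator (a : freegroup X * nat) := a.1 ^+ (p ^ a.2)%N.

Definition kills (P : finGroupType) (f : X -> P) :=
  forall a, a \in rs -> free_lift f (relator a) = 1.

Lemma kills_order (P : finGroupType) (f : X -> P) a : kills f -> a \in rs ->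
  #[free_lift f a.1] %| p ^ a.2.
Proof. by move=> kf /kf; rewrite gmulfXn /= => /eqP; rewrite order_dvdn. Qed.

(** The orders of the roots divide fixed powers of p, so their sum attains a maximum. A quotient
    covering a maximal one lowers no order, hence changes none. *)
Lemma exists_maximal_quotient : exists (P : finGroupType) (f : X -> P),
  kills f /\ forall (Q : finGroupType) (h : X -> Q), kills h ->
    (forall w, free_lift h w = 1 -> free_lift f w = 1) ->
    forall a, a \in rs -> #[free_lift h a.1] = #[free_lift f a.1].
Proof.
pose total (P : finGroupType) (f : X -> P) := (\sum_(a <- rs) #[free_lift f a.1])%N.
pose attained n := `[< exists (P : finGroupType) (f : X -> P), kills f /\ total P f = n >].
have ex_attained : exists n, attained n.
  (* The trivial group as a first candidate. *)
  pose T : finGroupType := {perm unit}.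
  exists (total T (fun=> 1)); apply/asboolP; exists T, (fun=> 1); split=> // a _.
  by apply/permP => x; apply/eqP; case: x; case: (X in X == _).
have bounded n : attained n -> (n <= \sum_(a <- rs) p ^ a.2)%N.
  move=> /asboolP[P [f [kf <-]]]; rewrite /total !big_seq.
  by apply: leq_sum => a /(kills_order kf)/dvdn_leq; apply; rewrite expn_gt0 prime_gt0.
case: (ex_maxnP ex_attained bounded) => n /asboolP[P [f [kf <-]]] maxf.
exists P, f; split=> // Q h kh hf.
have order_le a : (#[free_lift f a.1] <= #[free_lift h a.1])%N.
  apply: dvdn_leq => //; rewrite order_dvdn -(gmulfXn (free_lift f)).
  by apply/eqP/hf; rewrite gmulfXn; exact: expg_order.
have le_total : (total Q h <= total P f)%N by apply: maxf; apply/asboolP; exists Q, h.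
move=> a a_rs; apply/eqP; rewrite eqn_leq order_le andbT.
move: le_total; rewrite /total !(big_rem a a_rs) /= => le_total.
rewrite -(leq_add2r (\sum_(b <- rem a rs) #[free_lift f b.1])%N).
by apply: leq_trans le_total; rewrite leq_add2l leq_sum.
Qed.

Section Equations.
Variables (P : finGroupType) (f : X -> P).

Definition equation (j : P + P * freegroup X) (phi : {ffun P * X -> rat^o}) : rat^o :=
  match j with
  | inl g => divergence f phi g
  | inr c => path_int f phi c.1 c.2
  end.

Lemma equation_linear j : linear (equation j).
Proof.
case: j => [g|c]; [exact: divergence_linear|exact: path_int_linear].
Qed.

HB.instance Definition _ j := GRing.isLinear.Build rat {ffun P * X -> rat^o} rat^o
  _ (equation j) (equation_linear j).

Lemma exists_cochain (R : realFieldType) : kills f ->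
    (\sum_(a <- rs) (p%:R ^- a.2 : R) + 1 < #|X|%:R)%R ->
  exists phi : P * X -> int,
    (exists g w, free_lift f w = 1 /\ path_int f phi g w != 0%R) /\
    forall a g, a \in rs -> #[free_lift f a.1] = (p ^ a.2)%N ->
      path_int f phi g (relator a) = 0%R.
Proof.
move=> kf defp.
pose full := [seq a <- rs | #[free_lift f a.1] == (p ^ a.2)%N].
(* A coset of a subgroup of order p^k stands for p^k base points with the same integral, whence |P|
   / p^k equations. *)
pose cosets (a : freegroup X * nat) := enum (lcosets <[free_lift f a.1]> [set: P]%SET).
pose eqs : seq (P + P * freegroup X) := [seq inl g | g <- enum P] ++
  [seq inr (repr C, relator a) | a <- full, C <- cosets a].
have size_eqs : (size eqs < \dim {: {ffun P * X -> rat^o}})%N.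
  rewrite dimvf.
  have -> : dim {ffun P * X -> rat^o} = (#|P| * #|X|)%N by rewrite -card_prod -[RHS]muln1.
  rewrite size_cat size_map -cardE size_allpairs_dep sumnE big_map big_filter.
  rewrite -(ltr_nat R) natrD natr_sum natrM.
  (* This is the hypothesis multiplied by |P|: a relator in [full] accounts for |P| p^-k equations,
     any other relator for none. *)
  apply: le_lt_trans (_ : #|P|%:R * (\sum_(a <- rs) (p%:R ^- a.2 : R) + 1) < _)%R.
    rewrite mulrDr mulr1 addrC lerD2r mulr_sumr.
    rewrite big_mkcond /=; apply: ler_sum => a _.
    have pk0 : (0 < p%:R ^+ a.2 :> R)%R by rewrite exprn_gt0 ?ltr0n ?prime_gt0.
    case: eqP => [order_a|_]; last by rewrite mulr_ge0 ?ler0n // invr_ge0 ltW.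
    rewrite ler_pdivlMr // -natrX -order_a -natrM ler_nat.
    by rewrite -cardE card_lcosets -cardsT -(Lagrange (finset.subsetT <[free_lift f a.1]>)) mulnC.
  rewrite ltr_pM2l //.
  by rewrite ltr0n; apply/card_gt0P; exists 1.
have [phi0 phi0_neq0 phi0E] := common_zero_neq0 equation size_eqs.
have [N N0 [phi phiE]] := clear_denominators phi0.
have intE g (w : freegroup X) :
    ((path_int f phi g w)%:~R = N * path_int f phi0 g w :> rat)%R.
  transitivity (equation (inr (g, w)) (N *: phi0)%R : rat); last exact: linearZ.
  rewrite -(path_int_raddf f (intmul (1 : rat))).
  by congr (path_int f _ g w); apply/funext => y /=; rewrite ffunE -phiE.
exists phi; split=> [|a g a_rs order_a].
  (* Otherwise [phi0] is divergence free with zero integral over every loop, hence zero. *)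
  apply: contrapT => no_loop; move/eqP: phi0_neq0; apply.
  apply: (harmonic_eq0 (f := f)) => [g|g w w1].
    have /phi0E // : inl g \in eqs by rewrite mem_cat map_f // mem_enum.
  apply/eqP; apply: contrapT => loop; apply: no_loop; exists g, w; split=> //.
  by rewrite -(intr_eq0 rat) intE mulf_neq0 //; apply/negP.
apply/eqP; rewrite -(intr_eq0 rat) intE mulf_eq0 (negPf N0) /=; apply/eqP.
(* The equation was imposed at the representative of the coset of [g]; rotating the loop moves the
   base point there. *)
pose C := g *: <[free_lift f a.1]>.
have /mem_repr : g \in C by rewrite lcoset_refl.
move=> /lcosetP[_ /cycleP[i ->] reprC].
rewrite -(path_int_powX _ _ i) -?reprC; last exact: kf.
have /phi0E // : inr (repr C, relator a) \in eqs.
rewrite mem_cat; apply/orP; right; apply/allpairsPdep; exists a, C; split=> //.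
  by rewrite mem_filter order_a eqxx.
by rewrite mem_enum; apply/lcosetsP; exists g; rewrite ?inE.
Qed.

End Equations.
(** The null loops of the cochain form a normal subgroup containing all relators, whereas the n-th
    power of a loop with nonzero integral has n times that integral. *)
Lemma relators_infinite_order (R : realFieldType) :
    (\sum_(a <- rs) (p%:R ^- a.2 : R) + 1 < #|X|%:R)%R ->
  exists w, forall n, (0 < n)%N ->
    ~ normal_closure [set relator a | a in [set` rs]] (w ^+ n).
Proof.
move=> defp; have [P [f [kf maxf]]] := exists_maximal_quotient.
have [phi [[g0 [w [w1 loop]]] phi_full]] := exists_cochain kf defp.
pose v (a : freegroup X * nat) := a.1 ^+ #[free_lift f a.1].
have v1 a : free_lift f (v a) = 1 by rewrite gmulfXn; exact: expg_order.
have relatorE a : a \in rs -> relator a = v a ^+ (p ^ a.2 %/ #[free_lift f a.1])%N.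
  by move=> /(kills_order kf) d; rewrite -expgM mulnC divnK.
(* If p ^ e divides the integrals over all the v a, then p ^ e.+1 divides those
   over the relators, so that integration mod p ^ e.+1 extends f to a larger
   quotient; by maximality the v a die there. *)
have relator_dvd e : (forall a g, a \in rs -> #[free_lift f a.1] != (p ^ a.2)%N ->
      (p ^ e %| `|path_int f phi g (v a)|)%N) ->
    forall a g, a \in rs -> (p ^ e.+1 %| `|path_int f phi g (relator a)|)%N.
  move=> dvd_v a g a_rs; have [order_a|order_a] := eqVneq #[free_lift f a.1] (p ^ a.2)%N.
    by rewrite phi_full.
  rewrite relatorE // path_int_loopX // -mulr_natr natz abszM absz_nat expnSr.
  apply: dvdn_mul; first exact: dvd_v.
  have /(dvdn_pfactor _ _ p_prime)[j j_le order_j] := kills_order kf a_rs.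
  rewrite order_j in order_a *; rewrite -expnB ?prime_gt0 //.
  rewrite dvdn_exp // subn_gt0 ltn_neqAle j_le andbT.
  by apply: contraNneq order_a => ->.
have v_dvd e a g : a \in rs -> #[free_lift f a.1] != (p ^ a.2)%N ->
    (p ^ e %| `|path_int f phi g (v a)|)%N.
  elim: e a g => [|e IH] a g a_rs order_a; first by rewrite dvd1n.
  have q_gt1 : (1 < p ^ e.+1)%N by rewrite -(exp1n e.+1) ltn_exp2r ?prime_gt1.
  pose h : {additive int -> 'Z_(p ^ e.+1)} := intmul (1 : 'Z_(p ^ e.+1)).
  have [F FE] := affine_action f (h \o phi).
  have kF : kills F.
    move=> b b_rs; apply/permP => -[g1 z]; rewrite FE path_int_raddf kf // perm1 mulg1.
    congr (_, _); rewrite -[RHS]addr0; congr (_ + _)%R; apply/eqP.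
    by rewrite /h intr_Zp_eq0 // relator_dvd.
  have Ff u : free_lift F u = 1 -> free_lift f u = 1.
    move=> Fu; have := FE u 1 0%R; rewrite Fu perm1 mul1g => -[<-].
    by [].
  have Fv : free_lift F (v a) = 1.
    by rewrite gmulfXn -(maxf _ F kF Ff) //; exact: expg_order.
  (* The second coordinate of the image of (g, 0) is the integral modulo p^(e+1). *)
  have := FE (v a) g 0%R; rewrite Fv perm1 path_int_raddf add0r => -[_ /esym/eqP].
  by rewrite /h intr_Zp_eq0.
have relator0 a g : a \in rs -> path_int f phi g (relator a) = 0%R.
  move=> a_rs; apply/eqP; rewrite -absz_eq0; set z := `|_|%N.
  (* With e = z, the divisor p^(z+1) exceeds z, which forces z = 0. *)
  have z_dvd : (p ^ z.+1 %| z)%N by apply: relator_dvd => // *; exact: v_dvd.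
  case: (posnP z) => [//|z_gt0]; have := dvdn_leq z_gt0 z_dvd.
  rewrite leqNgt (leq_trans (ltnSn z)) // ltnW // ltn_expl //.
  exact: prime_gt1.
exists w => n n_gt0 wn.
have : null_loops f phi (w ^+ n).
  apply: smallest_sub wn => [|_ /= [a a_rs <-]]; first exact: null_loops_normal.
  by split=> [|g]; [exact: kf|exact: relator0].
move=> [_ /(_ g0)]; rewrite path_int_loopX // => /eqP.
by rewrite mulrn_eq0 (negPf loop) orbF => /eqP n0; rewrite n0 in n_gt0.
Qed.

End Relators.

(** * From the deficiency to finitely many relators *)

Section Deficiency.
Variables (R : realType) (p : nat) (X : finType).
Hypothesis p_prime : prime p.
Implicit Types (rels : set (freegroup X)) (t : seq (freegroup X)).

Lemma nu_weight_gt0 (r : freegroup X) : r != 1 -> (0 < nu_weight R p r)%R.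
Proof.
move=> /(nu_neq1 (prime_gt1 p_prime))[k nu_r].
by rewrite /nu_weight nu_r invr_gt0 exprn_gt0 // ltr0n prime_gt0.
Qed.

Lemma pdef_le rels t : uniq t -> [set` t] `<=` rels ->
  (pdef R p rels <= (#|X|%:R - \sum_(r <- t) nu_weight R p r)%:E)%E.
Proof.
move=> uniq_t t_rels; rewrite /pdef EFinB leeB //.
apply: esum_ge; exists [set` t]; first by split=> //; exact: finite_seq.
by rewrite -fsbig_seq // sumEFin.
Qed.

(** In the boundary case an infinite [rels] supplies a further relator outside [t], whose positive
    weight makes the inequality strict. *)
Lemma finite_relators_sum_lt rels t : uniq t -> [set` t] `<=` rels ->
    (1 < pdef R p rels)%E \/ infinite_set rels /\ pdef R p rels = 1%E ->
  (\sum_(r <- t) nu_weight R p r + 1 < #|X|%:R)%R.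
Proof.
move=> uniq_t t_rels [def_gt1|[inf_rels def_eq1]].
  by have := lt_le_trans def_gt1 (pdef_le uniq_t t_rels); rewrite lte_fin ltrBrDl.
(* The trivial relator is excluded because its weight is 0. *)
have [r [rels_r r_t]] : exists r, rels r /\ r \notin 1 :: t.
  apply: contrapT => no_r; apply: inf_rels.
  apply: (sub_finite_set (B := [set` 1 :: t])) => [r rels_r|]; last exact: finite_seq.
  by apply: contrapT => r_t; apply: no_r; exists r; split=> //; apply/negP.
move: r_t; rewrite inE negb_or => /andP[r_neq1 r_t].
have : (pdef R p rels <= (#|X|%:R - \sum_(r <- r :: t) nu_weight R p r)%:E)%E.
  apply: pdef_le => [|u]; first by rewrite /= r_t.
  by rewrite /= inE => /predU1P[->|/t_rels].
rewrite def_eq1 lee_fin lerBrDl big_cons; apply: lt_le_trans.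
by rewrite ltrD2r ltrDr nu_weight_gt0.
Qed.

End Deficiency.

Theorem corollary2p4 (R : realType) :
  ~ exists G : groupType,
      [/\ infinite_set [set: G], finitely_presented G, torsion G &
          exists2 p : nat, prime p &
            (exists (X : finType) (rels : set (freegroup X)),
               has_presentation G rels /\ (1 < pdef R p rels)%E)
            \/
            (exists (X : finType) (rels : set (freegroup X)),
               [/\ has_presentation G rels, infinite_set rels &
                   pdef R p rels = 1%E])].
Proof.
move=> [G [_ fpG torG [p p_prime def_cases]]].
have [X [rels [[phi [phi_surj kerphi]] def_rels]]] : exists (X : finType)
    (rels : set (freegroup X)), has_presentation G rels /\
    ((1 < pdef R p rels)%E \/ infinite_set rels /\ pdef R p rels = 1%E).
  case: def_cases => [[X [rels [pres def_gt1]]]|[X [rels [pres inf def_eq1]]]].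
    by exists X, rels; split=> //; left.
  by exists X, rels; split=> //; right.
have [s kers] := finitely_presented_kernel fpG phi_surj.
(* The kernel is the normal closure of finitely many elements, each of which needs only finitely
   many relators of [rels]. *)
have [|t t_rels st] := @normal_closure_finite_sub _ rels s.
  by rewrite -kerphi kers; exact: sub_gen_smallest.
(* Each weight must be counted once, and the trivial relator has no maximal root exponent. *)
pose u := [seq r <- undup t | r != 1].
have uniq_u : uniq u by rewrite filter_uniq ?undup_uniq.
have u_rels : [set` u] `<=` rels.
  by move=> r; rewrite /= mem_filter mem_undup => /andP[_ /t_rels].
have keru : phi @^-1` [set 1] `<=` normal_closure [set` u].
  rewrite kers => w /(normal_closure_sub st); apply: normal_closure_sub => r rt.
  have [->|r_neq1] := eqVneq r 1; first by case: (normal_closure_normal [set` u]).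
  by apply: sub_gen_smallest; rewrite /= mem_filter r_neq1 mem_undup.
(* The premise [r != 1] stands inside the existential so that choice yields a total function, with a
   dummy value at 1. *)
have ex_root r : exists a : freegroup X * nat, r != 1 ->
    relator p a = r /\ nu_weight R p r = (p%:R ^- a.2)%R.
  have [->|r_neq1] := eqVneq r 1; first by exists (1, 0%N).
  have [k nu_r] := nu_neq1 (prime_gt1 p_prime) r_neq1.
  have [[w wr] _] := (nuP _ _ _).1 nu_r.
  by exists (w, k) => _; split=> //; rewrite /nu_weight nu_r.
have [root rootE] := choice ex_root.
have u_neq1 r : r \in u -> r != 1 by rewrite mem_filter => /andP[].
have [|w w_inf] := @relators_infinite_order X p (map root u) p_prime R.
  rewrite big_map (_ : (\sum_(r <- u) _ = \sum_(r <- u) nu_weight R p r)%R).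
    exact: finite_relators_sum_lt uniq_u u_rels def_rels.
  by rewrite !big_seq; apply: eq_bigr => r /u_neq1/rootE[].
(* Torsion puts a positive power of [w] into the kernel, against its infinite order modulo the
   relators in [u]. *)
have [n n_gt0 wn] := torG (phi w).
apply: (w_inf n n_gt0).
have : normal_closure [set` u] (w ^+ n).
  have phiE : phi =1 free_lift (phi \o @freegen X) by exact: free_lift_unique.
  by apply: keru; rewrite /= phiE gmulfXn /= -phiE.
apply: normal_closure_sub => r ru; apply: sub_gen_smallest.
have [rE _] := rootE _ (u_neq1 _ ru).
by exists (root r) => //=; exact: map_f.
Qed.
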